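(* Let $F8$ denote the $3$-cube graph. For each positive integer $m\equiv 2\pmod 4$, the graph $K(mF8)$ is a connected Cayley graph that has no Hamilton decomposition.
   Context: The $3$-cube graph has vertex set $\{0,1\}^3$, with two vertices adjacent if and only if they differ in exactly one coordinate. For a graph $X$ and positive integer $m$, $mX$ is the multigraph on the vertices of $X$ with $m$ distinct edges $\{x,y\}_0,\ldots,\{x,y\}_{m-1}$ joining $x$ and $y$ for each edge $\{x,y\}$ of $X$. Its arcs are $(x,y)_0,\ldots,(x,y)_{m-1}$ for each arc $(x,y)$ of $X$ (an arc being an ordered pair of adjacent vertices), the two arcs $(x,y)_i$ and $(y,x)_i$ being associated with the edge $\{x,y\}_i$. For $X$ regular of valency $k\ge 1$, $K(mX)$ is the simple graph whose vertices are the arcs of $mX$, in which two distinct vertices are adjacent if and only if either they are arcs emanating from the same vertex (i.e. $(x,y)_i$ and $(x,z)_j$), or they are $(x,y)_i$ and $(y,x)_i$ for some edge $\{x,y\}_i$ of $mX$. It is $km$-valent. A Hamilton decomposition of a $d$-valent graph is a set of $\lfloor d/2\rfloor$ pairwise edge-disjoint Hamilton cycles in it. A graph is a Cayley graph if it is isomorphic to $\mathrm{Cay}(G;S)$ for some group $G$ and some inverse-closed subset $S\subseteq G$ not containing the identity, where $\mathrm{Cay}(G;S)$ has vertex set $G$ and edges $\{g,gs\}$ for $g\in G$, $s\in S$; equivalently, its automorphism group has a subgroup acting regularly on the vertices. *)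

(* Defs.v *)
From HB Require Import structures.
From mathcomp Require Import all_boot all_fingroup.

Set Implicit Arguments.
Unset Strict Implicit.
Unset Printing Implicit Defensive.

Record sgraph := SGraph {
  vertex :> finType;
  adj : rel vertex;
  adj_sym : symmetric adj;
  adj_irr : irreflexive adj
}.

Definition regular (X : sgraph) (k : nat) : Prop :=
  forall x : X, #|[set y | adj x y]| = k.

Definition connected (X : sgraph) : Prop :=
  0 < #|X| /\ forall x y : X, connect (@adj X) x y.

Definition isomorphic (X Y : sgraph) : Prop :=
  exists2 f : X -> Y, bijective f & forall x y, adj x y = adj (f x) (f y).

Definition cube_adj : rel (3.-tuple bool) :=
  [rel x y | #|[set i | tnth x i != tnth y i]| == 1].

Lemma cube_adj_sym : symmetric cube_adj.
Proof.
move=> x y; rewrite /cube_adj /=; congr (_ == _).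
by apply: eq_card => i; rewrite !inE eq_sym.
Qed.

Lemma cube_adj_irr : irreflexive cube_adj.
Proof.
move=> x; rewrite /cube_adj /= (_ : [set i | _] = set0) ?cards0 //.
by apply/setP => i; rewrite !inE eqxx.
Qed.

Definition F8 : sgraph := SGraph cube_adj_sym cube_adj_irr.

(* The arc (x, y)_i of the multigraph mX is encoded as the triple (x, y, i). *)
Definition marc (X : sgraph) (m : nat) :=
  {a : X * X * 'I_m | adj a.1.1 a.1.2}.

Section Arcs.
Variables (X : sgraph) (m : nat).
Implicit Types a b : marc X m.

Definition atail a : X := (val a).1.1.
Definition ahead a : X := (val a).1.2.
Definition aidx a : 'I_m := (val a).2.

Definition K_adj : rel (marc X m) :=
  [rel a b | (a != b) &&
    ((atail a == atail b) ||
     [&& atail b == ahead a, ahead b == atail a & aidx b == aidx a])].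

Lemma K_adj_sym : symmetric K_adj.
Proof.
move=> a b; rewrite /K_adj /= eq_sym (eq_sym (atail a) (atail b)).
rewrite (eq_sym (atail b) (ahead a)) (eq_sym (ahead b)) (eq_sym (aidx b)).
by rewrite andbCA.
Qed.

Lemma K_adj_irr : irreflexive K_adj.
Proof. by move=> a; rewrite /K_adj /= eqxx. Qed.

End Arcs.

Definition K (m : nat) (X : sgraph) : sgraph :=
  SGraph (@K_adj_sym X m) (@K_adj_irr X m).

Section Cayley.
Variables (gT : finGroupType) (S : {set gT}).
Hypothesis S_not1 : 1%g \notin S.
Hypothesis S_inv : forall s, s \in S -> (s^-1)%g \in S.

Definition cay_adj : rel gT := [rel g h | [exists s in S, h == (g * s)%g]].

Lemma cay_adj_sym : symmetric cay_adj.
Proof.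
have sub g h : cay_adj g h -> cay_adj h g.
  rewrite /cay_adj /= => /exists_inP[s Ss /eqP->]; apply/exists_inP.
  by exists (s^-1)%g; rewrite ?S_inv ?mulgK.
by move=> g h; apply/idP/idP; apply: sub.
Qed.

Lemma cay_adj_irr : irreflexive cay_adj.
Proof.
move=> g; rewrite /cay_adj /=; apply/exists_inP => -[s Ss /eqP gs].
have s1 : s = 1%g by apply: (mulgI g); rewrite -gs mulg1.
by move: S_not1; rewrite -s1 Ss.
Qed.

Definition Cay : sgraph := SGraph cay_adj_sym cay_adj_irr.

End Cayley.

Definition is_cayley (X : sgraph) : Prop :=
  exists (gT : finGroupType) (S : {set gT}) (S1 : 1%g \notin S)
    (SV : forall s, s \in S -> (s^-1)%g \in S),
  isomorphic X (Cay S1 SV).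

Definition cycle_edges (T : finType) (c : seq T) : {set {set T}} :=
  [set [set x; next c x] | x in c].

(* A Hamilton cycle is identified with its edge set, so that cyclic shifts
   and reversals of the same vertex sequence are not counted as distinct. *)
Definition hamilton_cycle (X : sgraph) (C : {set {set X}}) : Prop :=
  exists c : seq X,
    [/\ 2 < size c, ucycle (@adj X) c, forall x, x \in c & C = cycle_edges c].

(* [d] is meant to be the valency of X; see [K_regular] and [F8_regular]. *)
Definition hamilton_decomposition (X : sgraph) (d : nat)
    (D : {set {set {set X}}}) : Prop :=
  [/\ #|D| = d./2,
      forall C, C \in D -> hamilton_cycle C &
      forall C1 C2, C1 \in D -> C2 \in D -> C1 != C2 -> [disjoint C1 & C2]].

Lemma F8_regular : regular F8 3.
Proof.
move=> x.
pose flip (i : 'I_3) : F8 := [tuple tnth x j (+) (j == i) | j < 3].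
have flip_inj : injective flip.
  move=> i j /(congr1 (fun t => tnth t i)).
  by rewrite !tnth_mktuple eqxx => /addbI; case: eqP.
rewrite -[RHS]card_ord -(card_codom flip_inj); apply: eq_card => y.
rewrite !inE; apply/cards1P/codomP => [[i xy]|[i ->]]; exists i.
  apply: eq_from_tnth => j; move/setP/(_ j): xy; rewrite !inE tnth_mktuple => <-.
  by case: (tnth x j); case: (tnth y j).
by apply/setP => j; rewrite !inE tnth_mktuple; case: (j == i); case: (tnth x j).
Qed.

Lemma K_regular (m : nat) (X : sgraph) (k : nat) :
  regular X k -> regular (K m X) (k * m).
Proof.
move=> Xk a.
have ra : adj (ahead a, atail a, aidx a).1.1 (ahead a, atail a, aidx a).1.2.
  by rewrite /= adj_sym; apply: (valP a).
pose r : marc X m := Sub (ahead a, atail a, aidx a) ra.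
have tail_r : atail r != atail a.
  apply/eqP => e; have {}e : ahead a = atail a by exact: e.
  by have := valP a; rewrite -/(ahead a) -/(atail a) e adj_irr.
pose A := [set b : marc X m | atail b == atail a].
have -> : [set b | @adj (K m X) a b] = r |: A :\ a.
  apply/setP => b; rewrite !inE /= /K_adj /= (eq_sym a) (eq_sym (atail a)).
  have -> : [&& atail b == ahead a, ahead b == atail a & aidx b == aidx a]
            = (b == r).
    rewrite -(val_eqE b r) [val r]/= [val b]surjective_pairing.
    by rewrite [(val b).1]surjective_pairing !xpair_eqE -andbA.
  have [->|_] := eqVneq b r; last by rewrite orbF.
  by rewrite orbT andbT; apply: contraNneq tail_r => ->.
rewrite cardsU1 !inE (negPf tail_r) andbF /=.
have aA : a \in A by rewrite inE.
have := cardsD1 a A; rewrite aA /= => <-.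
rewrite -(Xk (atail a)) -[X in _ = _ * X]card_ord -cardsT -cardsX.
pose f (b : marc X m) := (ahead b, aidx b).
have f_inj : {in A &, injective f}.
  move=> b c; rewrite !inE => /eqP tb /eqP tc [hb ib]; apply: val_inj.
  rewrite [val b]surjective_pairing [val c]surjective_pairing.
  rewrite [(val b).1]surjective_pairing [(val c).1]surjective_pairing.
  by congr (_, _, _) => //; rewrite -[LHS]/(atail b) tb -tc.
rewrite -(card_in_imset f_inj); apply: eq_card => -[y i].
rewrite !inE andbT; apply/imsetP/idP => [[b]|xy].
  by rewrite inE => /eqP<- [-> _]; apply: (valP b).
by exists (Sub (atail a, y, i) xy); rewrite ?inE.
Qed.

(* Main.v *)
Require Import Defs.
From HB Require Import structures.
From mathcomp Require Import all_boot all_fingroup.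
From mathcomp Require Import ssralg zmodp zify.

Set Implicit Arguments.
Unset Strict Implicit.
Unset Printing Implicit Defensive.

(** In [K m X] the arcs with a given tail form a clique, and every arc has a
    single further neighbour, its reverse; the edge joining an arc to its
    reverse is called a link below.  Since links are the only way out of a
    clique, a Hamilton cycle uses at least two of the links at each vertex of
    [X].  There are [k * m] links at each vertex, and a Hamilton decomposition
    consists of [k * m / 2] disjoint cycles when [k * m] is even, so each cycle
    uses exactly two links at each vertex and each link lies on exactly one
    cycle.  Contracting the cliques therefore turns a Hamilton decomposition of
    [K m X] into a family of connected 2-factors of the multigraph [mX] that
    together cover each edge of [X] exactly [m] times ([hamilton_trace]).

    On the cube such a 2-factor is one of the six Hamilton cycles, and each of
    these uses all four edges of one direction and two edges of each of the two
    other directions.  Call the directions x, y, z.  Counting edges of direction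
    x shows that exactly [m / 2] of the [3 * m / 2] cycles use all x-edges.
    These are precisely the cycles that use exactly one of the two y-edges of
    the face z = 0; the others use none or both.  The two y-edges are used
    [2 * m] times in all, so the number [m / 2] is even, which is false when
    [m] is 2 modulo 4.  Both counts are combined in a single congruence modulo 4
    ([cube_trace_mod4]), which is then summed over the decomposition.

    For the Cayley property, the eight translations of the cube together with
    the cyclic rotation of the three coordinates form a wreath product of order
    24 acting regularly on the arcs of the cube; its product with the cyclic
    group of order [m], which shifts the edge indices, acts regularly on the
    vertices of [K m F8] ([is_cayley_KF8]). *)

(** * Arcs, cliques and links *)

Section Arcs.
Variables (X : sgraph) (m : nat).
Implicit Types (x y : X) (a b : K m X) (C : {set {set K m X}}).

Lemma marc_inj a b :
  atail a = atail b -> ahead a = ahead b -> aidx a = aidx b -> a = b.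
Proof.
move=> et eh ei; apply: val_inj; move: et eh ei.
rewrite /atail /ahead /aidx.
by case: (val a) (val b) => [[? ?] ?] [[? ?] ?] /= -> -> ->.
Qed.

Lemma rev_arc_proof a :
  adj (ahead a, atail a, aidx a).1.1 (ahead a, atail a, aidx a).1.2.
Proof. by rewrite adj_sym; apply: (valP a). Qed.

Definition rev_arc a : K m X :=
  Sub (ahead a, atail a, aidx a) (rev_arc_proof a).

Lemma rev_arcK : involutive rev_arc.
Proof. by move=> a; apply: marc_inj. Qed.

Lemma tail_rev_arc a : atail (rev_arc a) = ahead a.
Proof. by []. Qed.

Lemma head_rev_arc a : ahead (rev_arc a) = atail a.
Proof. by []. Qed.

Lemma adj_arc a : adj (atail a) (ahead a).
Proof. exact: (valP a). Qed.

Lemma K_adjE a b :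
  adj a b = (a != b) && ((atail a == atail b) || (b == rev_arc a)).
Proof.
rewrite /= /K_adj /=; congr (_ && (_ || _)).
apply/and3P/eqP => [[/eqP et /eqP eh /eqP ei]|->]; first exact: marc_inj.
by rewrite !eqxx.
Qed.

Lemma adj_rev_arc a : adj a (rev_arc a).
Proof.
rewrite K_adjE eqxx orbT andbT; apply/eqP => /(congr1 (@atail X m)) e.
by have := adj_arc a; rewrite -tail_rev_arc -e adj_irr.
Qed.

Lemma card_parallel_arcs x y :
  #|[set a : K m X | (atail a == x) && (ahead a == y)]| <= adj x y * m.
Proof.
have [xy|nxy] := boolP (adj x y); last first.
  rewrite leqn0 cards_eq0; apply/eqP/setP => a; rewrite !inE.
  apply/andP => -[/eqP ex /eqP ey].
  by have := adj_arc a; rewrite ex ey (negPf nxy).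
rewrite mul1n -[X in _ <= X]card_ord.
rewrite -(@card_in_imset _ _ (@aidx X m)) ?max_card // => a b.
rewrite !inE => /andP[/eqP ta /eqP ha] /andP[/eqP tb /eqP hb].
by apply: marc_inj; rewrite ?ta ?ha.
Qed.

Lemma connected_K k :
  regular X k -> 0 < k -> 0 < m -> connected X -> connected (K m X).
Proof.
move=> Xk k_gt0 m_gt0 [/card_gt0P[x0 _] Xc]; split.
  have /card_gt0P[y] : 0 < #|[set y | adj x0 y]| by rewrite Xk.
  rewrite inE => xy; apply/card_gt0P.
  by exists (Sub (x0, y, Ordinal m_gt0) xy : K m X).
have sametail a b : atail a = atail b -> connect (@adj (K m X)) a b.
  move=> ab; have [->|anb] := eqVneq a b; first exact: connect0.
  by apply: connect1; rewrite K_adjE anb ab eqxx.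
move=> a b; have /connectP[p] := Xc (atail a) (atail b).
elim: p a => [|y p IH] a /=; first by move=> _ /esym/sametail.
case/andP=> ay yp eb.
pose a' : K m X := Sub (atail a, y, aidx a) ay.
apply: connect_trans (sametail a a' erefl) _.
by apply: connect_trans (connect1 (adj_rev_arc a')) _; apply: IH.
Qed.

Definition link_arc C a := [set a; rev_arc a] \in C.

Lemma link_arc_rev C a : link_arc C (rev_arc a) = link_arc C a.
Proof. by rewrite /link_arc rev_arcK setUC. Qed.

(** The multigraph on [X] left by the links of [C] once each clique of arcs
    with a common tail is contracted to a point. *)
Definition link_weight C x y :=
  #|[set a : K m X | [&& atail a == x, ahead a == y & link_arc C a]]|.

Lemma link_weightC C x y : link_weight C x y = link_weight C y x.
Proof.
rewrite /link_weight -(card_imset _ (inv_inj rev_arcK)).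
apply: eq_card => a; rewrite (can_imset_pre _ rev_arcK) !inE.
by rewrite tail_rev_arc head_rev_arc link_arc_rev andbCA.
Qed.

Lemma sum_link_weight C x :
  \sum_y link_weight C x y =
    #|[set a : K m X | (atail a == x) && link_arc C a]|.
Proof.
rewrite -sum1_card (partition_big (fun a : K m X => ahead a) predT) //=.
apply: eq_bigr => y _; rewrite /link_weight -sum1_card.
by apply: eq_bigl => a; rewrite !inE -andbA [link_arc C a && _]andbC.
Qed.

(** A link lies on at most one member of a disjoint family, and at most [m]
    links run from [x] to [y]. *)
Lemma sum_link_weight_le (D : {set {set {set K m X}}}) x y :
  (forall C1 C2, C1 \in D -> C2 \in D -> C1 != C2 -> [disjoint C1 & C2]) ->
  \sum_(C in D) link_weight C x y <= adj x y * m.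
Proof.
move=> Ddis; apply: leq_trans (card_parallel_arcs x y).
have -> : \sum_(C in D) link_weight C x y
    = \sum_(a : K m X | (atail a == x) && (ahead a == y))
        #|[set C in D | link_arc C a]|.
  under eq_bigr do rewrite /link_weight -sum1_card.
  under [RHS]eq_bigr do rewrite -sum1_card.
  rewrite (exchange_big_dep
             (fun a : K m X => (atail a == x) && (ahead a == y))) /=.
    apply: eq_bigr => a /andP[ta ha]; apply: eq_bigl => C.
    by rewrite !inE ta ha.
  by move=> C a _; rewrite inE andbA => /andP[].
rewrite -sum1dep_card.
apply: leq_sum => a _; apply/card_le1_eqP => C1 C2; rewrite !inE.
move=> /andP[D1 C1a] /andP[D2 C2a]; apply/eqP/negPn/negP => C12.
have := disjointFr (Ddis _ _ D1 D2 _) C1a; rewrite eq_sym C12.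
by move=> /(_ isT); rewrite -/(link_arc _ _) C2a.
Qed.
End Arcs.

(** * Contracting a Hamilton decomposition *)

(** Otherwise [P] would be stable along the cycle, which reaches every point. *)
Lemma cycle_next_exit (T : finType) (c : seq T) (P : pred T) (s t : T) :
  uniq c -> (forall x, x \in c) -> P s -> ~~ P t ->
  exists2 a, P a & ~~ P (next c a).
Proof.
move=> Uc all_c Ps nPt.
have [/exists_inP[a Pa nPa]|] := boolP [exists a in P, ~~ P (next c a)].
  by exists a.
rewrite negb_exists_in => /forall_inP Pnext.
have st : fconnect (next c) s t by rewrite (fconnect_cycle (cycle_next Uc)).
case/negP: nPt; rewrite -(iter_findex st).
by elim: (findex _ _ _) => //= n IH; apply: (negbNE (Pnext _ IH)).
Qed.

Lemma next_next_neq (T : finType) (c : seq T) (a : T) :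
  uniq c -> (forall x, x \in c) -> 2 < size c -> next c (next c a) != a.
Proof.
move=> Uc all_c c_gt2; apply/eqP => nna.
have [t] : exists t, ~~ pred2 a (next c a) t.
  apply/existsP; rewrite -negb_forall; apply/negP => /forallP sub.
  have: size c <= size [:: a; next c a].
    by apply: uniq_leq_size => // x _; rewrite !inE; apply: sub.
  by rewrite leqNgt c_gt2.
move=> nt; have [|b] := cycle_next_exit Uc all_c (_ : pred2 a (next c a) a) nt.
  by rewrite /= eqxx.
by move=> /= /orP[]/eqP->; rewrite ?nna eqxx ?orbT.
Qed.

(** Connectedness is expressed by cuts: the weight is positive somewhere across
    every partition of the vertices.  Weights are allowed to exceed 1, since an
    edge of the multigraph [mX] may be repeated. *)
Definition connected_2factor (X : sgraph) (w : X -> X -> nat) : Prop :=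
  [/\ forall x y, w x y = w y x,
      forall x y, 0 < w x y -> adj x y,
      forall x, \sum_y w x y = 2 &
      forall (U : pred X) u v, U u -> ~~ U v ->
        exists x y, [/\ U x, ~~ U y & 0 < w x y]].

Lemma arc_from (X : sgraph) (m k : nat) (x : X) :
  regular X k -> 0 < k -> 0 < m -> exists a : K m X, atail a = x.
Proof.
move=> Xk k_gt0 m_gt0.
have /card_gt0P[y] : 0 < #|[set y | adj x y]| by rewrite Xk.
by rewrite inE => xy; exists (Sub (x, y, Ordinal m_gt0) xy : K m X).
Qed.

(** The cycle has to leave [U] and to come back.  The two links used are
    distinct because a cycle with more than two vertices cannot cross a link and
    immediately return along it.  With [U] a single vertex this is the lower
    bound on degrees; with [U] arbitrary it is connectedness. *)
Lemma hamilton_cut (X : sgraph) (m k : nat) (C : {set {set K m X}})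
    (U : pred X) u v :
  regular X k -> 0 < k -> 0 < m -> hamilton_cycle C -> U u -> ~~ U v ->
  exists a b : K m X, [/\ a != b,
    [/\ U (atail a), ~~ U (ahead a) & link_arc C a] &
    [/\ U (atail b), ~~ U (ahead b) & link_arc C b]].
Proof.
move=> Xk k_gt0 m_gt0 [c [c_gt2 /andP[cc Uc] all_c ->]] Uu nUv.
have [a0 ta0] := arc_from u Xk k_gt0 m_gt0.
have [b0 tb0] := arc_from v Xk k_gt0 m_gt0.
(* The tail is constant on a clique, so only links can cross the cut. *)
have leave a : U (atail a) != U (atail (next c a)) -> next c a = rev_arc a.
  move=> Ua; have := next_cycle cc (all_c a); rewrite K_adjE => /andP[_].
  by case/orP => [/eqP ea|/eqP//]; rewrite ea eqxx in Ua.
have linked a : next c a = rev_arc a -> link_arc (cycle_edges c) a.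
  by move=> ea; rewrite /link_arc -ea; apply: imset_f.
have [||a Ua nUa] :=
  @cycle_next_exit _ c (fun a => U (atail a)) a0 b0 Uc all_c.
- by rewrite ta0.
- by rewrite tb0.
have [||b /= nUb] :=
  @cycle_next_exit _ c (fun a => ~~ U (atail a)) b0 a0 Uc all_c.
- by rewrite tb0.
- by rewrite ta0 negbK.
rewrite negbK => Ub.
have ea : next c a = rev_arc a by apply: leave; rewrite Ua (negPf nUa).
have eb : next c b = rev_arc b by apply: leave; rewrite Ub (negPf nUb).
(* The step at [b] enters [U]; its link leaves [U] when read backwards. *)
exists a, (rev_arc b); split.
- apply/eqP => ab; have := next_next_neq b Uc all_c c_gt2.
  by rewrite eb -ab ea ab rev_arcK eqxx.
- by split; [|rewrite -tail_rev_arc -ea|apply: linked].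
- split; [by rewrite -eb|by rewrite head_rev_arc|].
  by rewrite link_arc_rev; apply: linked.
Qed.

(** The disjoint cycles of [D] number half of [k * m] and each has degree at
    least 2 at [x] after contraction, while only [k * m] links are available
    there.  So both the lower bound for each cycle and the upper bound for each
    edge are attained. *)
Lemma hamilton_trace (X : sgraph) (m k : nat) (D : {set {set {set K m X}}}) :
    regular X k -> 0 < k -> 0 < m -> 1 < #|X| -> ~~ odd (k * m) ->
    hamilton_decomposition (k * m) D ->
  (forall C, C \in D -> connected_2factor (link_weight C)) /\
  (forall x y : X, adj x y -> \sum_(C in D) link_weight C x y = m).
Proof.
move=> Xk k_gt0 m_gt0 X_gt1 ev [cardD Dham Ddis].
have cut C (CD : C \in D) U u v :=
  @hamilton_cut X m k C U u v Xk k_gt0 m_gt0 (Dham C CD).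
have deg_ge2 C x : C \in D -> 2 <= \sum_y link_weight C x y.
  move=> CD; have [v nvx] : exists v, v != x.
    have : 0 < #|[set~ x]| by rewrite cardsC1; lia.
    by case/card_gt0P => v; rewrite !inE; exists v.
  have [a [b [ab [/eqP ta _ la] [/eqP tb _ lb]]]] :=
    cut C CD (pred1 x) x v (eqxx x) nvx.
  rewrite sum_link_weight; apply/card_gt1P; exists a, b; split=> //;
  by rewrite inE ?ta ?tb eqxx.
have total x : \sum_(C in D) \sum_y link_weight C x y =
    \sum_y \sum_(C in D) link_weight C x y.
  exact: exchange_big.
have ub x y := @sum_link_weight_le X m D x y Ddis.
have capx (x : X) : \sum_y adj x y * m = k * m.
  rewrite -big_distrl /= -(Xk x) -sum1_card [in RHS]big_mkcond; congr (_ * _).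
  by apply: eq_bigr => y _; rewrite inE; case: adj.
have lbx (x : X) : k * m <= \sum_(C in D) \sum_y link_weight C x y.
  apply: leq_trans (_ : \sum_(C in D) 2 <= _); last first.
    by apply: leq_sum => C CD; apply: deg_ge2.
  by rewrite sum_nat_const cardD; lia.
have eqd (x : X) : \sum_(C in D) 2 = \sum_(C in D) \sum_y link_weight C x y.
  apply/eqP; rewrite eqn_leq leq_sum ?andTb; last first.
    by move=> C CD; apply: deg_ge2.
  rewrite total (leq_trans (leq_sum _ (fun y _ => ub x y))) // capx.
  by rewrite sum_nat_const cardD; lia.
split=> [C CD|x y xy].
  split=> [x y|x y|x|U u v Uu Uv].
  - exact: link_weightC.
  - case/card_gt0P => a; rewrite inE => /and3P[/eqP<- /eqP<- _].
    exact: adj_arc.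
  - have [_] := leqif_sum (fun C CD => leqif_eq (deg_ge2 C x CD)).
    by rewrite (eqd x) eqxx => /esym/forall_inP/(_ C CD)/eqP.
  have [a [_ [_ [Ua Ha la] _]]] := cut C CD U u v Uu Uv.
  exists (atail a), (ahead a); split=> //; apply/card_gt0P; exists a.
  by rewrite inE !eqxx.
have [_] := leqif_sum (fun y (_ : true) => leqif_eq (ub x y)).
rewrite -total capx.
have -> : \sum_(C in D) \sum_y link_weight C x y == k * m.
  rewrite eqn_leq lbx andbT total -(capx x); exact: leq_sum.
by move/esym/forallP/(_ y)/eqP; rewrite xy mul1n.
Qed.

(** If an edge had weight 2, it would exhaust the degree of both its ends and
    nothing could leave the pair. *)
Lemma connected_2factor_le1 (X : sgraph) (w : X -> X -> nat) x y :
  2 < #|X| -> connected_2factor w -> w x y <= 1.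
Proof.
move=> X_gt2 [wC w_adj w2 w_cut].
have [v nv] : exists v, v \notin [set x; y].
  apply/existsP; rewrite -negb_forall; apply/negP => /forallP all_xy.
  have : #|X| <= #|[set x; y]|.
    by rewrite -cardsT; apply/subset_leq_card/subsetP => v _; apply: all_xy.
  by rewrite cards2; lia.
have [p [q [Up nUq wpq]]] := w_cut (mem [set x; y]) x v (set21 x y) nv.
have bound p' : p' != q -> w p p' <= 1.
  move=> p'q; have := w2 p.
  by rewrite (bigD1 p') // (bigD1 q) 1?eq_sym //=; lia.
move: Up nUq; rewrite /= !inE negb_or => /orP[]/eqP ep /andP[qx qy].
  by rewrite -ep bound // eq_sym.
by rewrite wC -ep bound // eq_sym.
Qed.

(** * The cube *)

Definition flip (x : F8) (i : 'I_3) : F8 :=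
  [tuple tnth x j (+) (j == i) | j < 3].

Lemma flip_inj x : injective (flip x).
Proof.
move=> i j /(congr1 (fun t => tnth t i)).
by rewrite !tnth_mktuple eqxx => /addbI; case: eqP.
Qed.

Lemma flipK i : involutive (flip^~ i).
Proof. by move=> x; apply: eq_from_tnth => j; rewrite !tnth_mktuple addbK. Qed.

Lemma cube_adjP (x y : F8) : reflect (exists i, y = flip x i) (adj x y).
Proof.
apply: (iffP cards1P) => -[i].
  move/setP => xy; exists i; apply: eq_from_tnth => j.
  rewrite tnth_mktuple; move: (xy j); rewrite !inE => <-.
  by case: (tnth x j); case: (tnth y j).
move=> ->; exists i; apply/setP => j; rewrite !inE tnth_mktuple.
by case: (j == i); case: (tnth x j).
Qed.

(** Flipping a coordinate where two vertices differ brings them closer. *)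
Lemma connected_F8 : connected F8.
Proof.
split; first by apply/card_gt0P; exists [tuple of nseq 3 false].
move=> x y; have [n] := ubnP #|[set i | tnth x i != tnth y i]|.
elim: n x => // n IH x; rewrite ltnS => dxy.
have [i xyi|same] := pickP (fun i => tnth x i != tnth y i); last first.
  suff -> : x = y by exact: connect0.
  by apply: eq_from_tnth => i; apply/eqP/negPn; rewrite same.
apply: (connect_trans (connect1 (_ : adj x (flip x i)))).
  by apply/cube_adjP; exists i.
apply/IH/(leq_trans _ dxy)/proper_card/properP; split.
  apply/subsetP => j; rewrite !inE tnth_mktuple.
  by have [->|_] := eqVneq j i; rewrite ?addbF // xyi.
exists i; rewrite !inE // tnth_mktuple eqxx.
by move: xyi; case: (tnth x i); case: (tnth y i).
Qed.

Lemma sum_flip (w : F8 -> F8 -> nat) x :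
  (forall y, 0 < w x y -> adj x y) -> \sum_y w x y = \sum_i w x (flip x i).
Proof.
move=> w_adj; rewrite (bigID (mem [set flip x i | i : 'I_3])) /=.
rewrite [X in _ + X]big1 ?addn0; last first.
  move=> y; apply: contraNeq; rewrite -lt0n => /w_adj/cube_adjP[i ->].
  exact: imset_f.
by rewrite big_imset //=; move=> i j _ _; apply: flip_inj.
Qed.

Definition vtx (a b c : bool) : F8 := [tuple a; b; c].

Lemma vtxE (x : F8) : exists a b c, x = vtx a b c.
Proof.
by case/tupleP: x => a x; case/tupleP: x => b x; case/tupleP: x => c x;
   exists a, b, c; apply: val_inj; rewrite /= (tuple0 x).
Qed.

Local Notation i0 := (@Ordinal 3 0 isT).
Local Notation i1 := (@Ordinal 3 1 isT).
Local Notation i2 := (@Ordinal 3 2 isT).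

Lemma flip_vtx a b c :
  [/\ flip (vtx a b c) i0 = vtx (~~ a) b c,
      flip (vtx a b c) i1 = vtx a (~~ b) c &
      flip (vtx a b c) i2 = vtx a b (~~ c)].
Proof.
by split; apply: eq_from_tnth => -[[|[|[|//]]] lt_i]; rewrite tnth_mktuple;
  rewrite /tnth /= ?addbT ?addbF.
Qed.

(** * The congruence modulo 4 *)

(** Here [x b c] is the weight of the edge in the first direction whose other
    two coordinates are [b] and [c], and similarly for [y] and [z].  The degree
    equations with weights at most 1 describe the nine 2-factors of the cube;
    three of them are pairs of opposite faces, which miss a direction, and the
    other six are the Hamilton cycles.  Such a cycle has four edges of the first
    direction and one of the two selected y-edges, or two edges of the first
    direction and an even number of the selected y-edges: in both cases the sum
    is 2 modulo 4. *)
Lemma cube_arith (x y z : bool -> bool -> nat) :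
  (forall a b c, x b c + y a c + z a b = 2) ->
  (forall b c, x b c <= 1) -> (forall a c, y a c <= 1) ->
  (forall a b, z a b <= 1) ->
  (exists b c, 0 < x b c) -> (exists a c, 0 < y a c) ->
  (exists a b, 0 < z a b) ->
  x false false + x false true + x true false + x true true +
    2 * (y false false + y true false) = 2 %[mod 4].
Proof.
move=> deg x1 y1 z1.
have tot (P : bool -> bool -> nat) : (exists a b, 0 < P a b) ->
    0 < P false false + P false true + P true false + P true true.
  by case=> -[] [[]]; lia.
move=> /tot x0 /tot y0 /tot z0.
have := deg false false false; have := deg false false true.
have := deg false true false; have := deg false true true.
have := deg true false false; have := deg true false true.
have := deg true true false; have := deg true true true.
have := x1 false false; have := x1 false true.
have := x1 true false; have := x1 true true.
have := y1 false false; have := y1 false true.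
have := y1 true false; have := y1 true true.
have := z1 false false; have := z1 false true.
have := z1 true false; have := z1 true true.
move: (x false false) (x false true) (x true false) (x true true) x0.
move: (y false false) (y false true) (y true false) (y true true) y0.
move: (z false false) (z false true) (z true false) (z true true) z0.
clear.
move=> z00 z01 z10 z11 z0 y00 y01 y10 y11 y0 x00 x01 x10 x11 x0.
lia.
Qed.

(** Connectedness provides the missing hypotheses of [cube_arith]: edges are not
    repeated, and some edge of each direction crosses between the two opposite
    faces orthogonal to it. *)
Lemma cube_trace_mod4 (w : F8 -> F8 -> nat) (u := vtx) : connected_2factor w ->
  w (u false false false) (u true false false) +
  w (u false false true) (u true false true) +
  w (u false true false) (u true true false) +
  w (u false true true) (u true true true) +
  2 * (w (u false false false) (u false true false) +
       w (u true false false) (u true true false)) = 2 %[mod 4].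
Proof.
rewrite {}/u => w2f; have [wC w_adj w2 w_cut] := w2f.
have w1 x y : w x y <= 1.
  by apply: connected_2factor_le1 w2f; rewrite card_tuple card_bool.
have cut i : exists x, tnth x i = false /\ 0 < w x (flip x i).
  pose all b : F8 := [tuple of nseq 3 b].
  have tall b : tnth (all b) i = b.
    by rewrite (tnth_nth false) nth_nseq ltn_ord.
  have [||x [y []]] := w_cut (fun x => ~~ tnth x i) (all false) (all true).
  - by rewrite tall.
  - by rewrite tall.
  move=> /negbTE xi; rewrite negbK => yi wxy.
  have /cube_adjP[j ey] := w_adj _ _ wxy; subst y.
  suff ij : j = i by subst j; exists x.
  by move: yi; rewrite tnth_mktuple xi; case: eqP.
apply: (cube_arith (x := fun b c => w (vtx false b c) (vtx true b c))
                   (y := fun a c => w (vtx a false c) (vtx a true c))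
                   (z := fun a b => w (vtx a b false) (vtx a b true))) => //.
- move=> a b c; rewrite -[RHS](w2 (vtx a b c)) sum_flip; last exact: w_adj.
  have [e0 e1 e2] := flip_vtx a b c.
  rewrite !big_ord_recl big_ord0 addn0 addnA.
  have -> : ord0 = i0 by apply: val_inj.
  have -> : lift i0 ord0 = i1 by apply: val_inj.
  have -> : lift i0 (lift ord0 ord0) = i2 by apply: val_inj.
  rewrite e0 e1 e2.
  by congr (_ + _ + _); [case: (a)|case: (b)|case: (c)] => //; apply: wC.
- have [x] := cut i0; have [a [b [c ->]]] := vtxE x.
  have [-> _ _] := flip_vtx a b c.
  by rewrite (tnth_nth false) /= => -[-> ?]; exists b, c.
- have [x] := cut i1; have [a [b [c ->]]] := vtxE x.
  have [_ -> _] := flip_vtx a b c.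
  by rewrite (tnth_nth false) /= => -[-> ?]; exists a, c.
- have [x] := cut i2; have [a [b [c ->]]] := vtxE x.
  have [_ _ ->] := flip_vtx a b c.
  by rewrite (tnth_nth false) /= => -[-> ?]; exists a, b.
Qed.

(** Summed over a decomposition, the quantity of [cube_trace_mod4] is [m] times
    its value for the weight 1 on all edges, namely [8 * m]. *)
Lemma K_F8_no_decomposition m D : m = 2 %[mod 4] ->
  ~ @hamilton_decomposition (K m F8) (3 * m) D.
Proof.
move=> m_mod4 hD; have m_gt0 : 0 < m by case: (m) m_mod4.
have ev : ~~ odd (3 * m) by lia.
have F8_gt1 : 1 < #|F8| by rewrite card_tuple card_bool.
have [D2f Dsum] := hamilton_trace F8_regular isT m_gt0 F8_gt1 ev hD.
have [cardD _ _] := hD.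
pose F (C : {set {set K m F8}}) :=
  link_weight C (vtx false false false) (vtx true false false) +
  link_weight C (vtx false false true) (vtx true false true) +
  link_weight C (vtx false true false) (vtx true true false) +
  link_weight C (vtx false true true) (vtx true true true) +
  2 * (link_weight C (vtx false false false) (vtx false true false) +
       link_weight C (vtx true false false) (vtx true true false)).
have sumF : \sum_(C in D) F C = 8 * m.
  have adj0 b c : adj (vtx false b c) (vtx true b c).
    by apply/cube_adjP; exists i0; have [->] := flip_vtx false b c.
  have adj1 a c : adj (vtx a false c) (vtx a true c).
    by apply/cube_adjP; exists i1; have [_ ->] := flip_vtx a false c.
  by rewrite /F !big_split /= big1_eq !Dsum ?adj0 ?adj1 //; lia.
(* Each of the [3 * m / 2] cycles contributes 2 modulo 4, in total [3 * m]. *)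
have := modn_summ (index_enum _) (mem D) F 4.
under eq_bigr => C CD do rewrite (cube_trace_mod4 (D2f C CD)).
rewrite sumF sum_nat_const cardD; lia.
Qed.

(** * A regular group of automorphisms *)

(** The wreath product of the group of order 2 by the cyclic group of order 3,
    as automorphisms of the cube: rotate the coordinates by the second component
    and then translate by the first. *)
Definition wreath : Type := 3.-tuple bool * 'I_3.
HB.instance Definition _ := Finite.on wreath.

Definition rot3 (j : 'I_3) (t : 3.-tuple bool) : 3.-tuple bool :=
  [tuple tnth t (i - j)%R | i < 3].
Definition xor3 (s t : 3.-tuple bool) : 3.-tuple bool :=
  [tuple tnth s i (+) tnth t i | i < 3].

Definition wmul (g h : wreath) : wreath :=
  (xor3 g.1 (rot3 g.2 h.1), (g.2 + h.2)%R).
Definition wone : wreath := ([tuple false | _ < 3], 0%R).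
Definition winv (g : wreath) : wreath := (rot3 (- g.2)%R g.1, (- g.2)%R).

Lemma wmulA : associative wmul.
Proof.
move=> [s i] [t j] [u k]; congr pair; last by rewrite /= GRing.addrA.
apply: eq_from_tnth => l; rewrite !tnth_mktuple /= GRing.opprD GRing.addrA.
by rewrite addbA.
Qed.

Lemma wmul1 : left_id wone wmul.
Proof.
move=> [t j]; congr pair; last by rewrite /= GRing.add0r.
by apply: eq_from_tnth => l; rewrite !tnth_mktuple /= GRing.subr0.
Qed.

Lemma wmulV : left_inverse wone winv wmul.
Proof.
move=> [t j]; congr pair; last by rewrite /= GRing.addNr.
by apply: eq_from_tnth => l; rewrite !tnth_mktuple /= addbb.
Qed.

HB.instance Definition _ := Finite_isGroup.Build wreath wmulA wmul1 wmulV.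

(** Sabidussi's criterion, with the regular action given by a parametrization
    [f] of the vertices by the group under which left translations preserve
    adjacency.  The connection set is the neighbourhood of the base point. *)
Lemma is_cayley_regular_param (X : sgraph) (gT : finGroupType) (f : gT -> X) :
    injective f -> (forall x, exists g, f g = x) ->
    (forall g h k, adj (f (g * h)%g) (f (g * k)%g) = adj (f h) (f k)) ->
  is_cayley X.
Proof.
move=> f_inj f_surj f_adj; pose S := [set s | adj (f 1%g) (f s)].
have S1 : 1%g \notin S by rewrite inE adj_irr.
have SV s : s \in S -> (s^-1)%g \in S.
  by rewrite !inE -(f_adj s^-1%g) mulg1 mulVg adj_sym.
exists gT, S, S1, SV.
have ex x : exists g, f g == x by have [g <-] := f_surj x; exists g.
pose f' x := xchoose (ex x).
have f'K : cancel f' f by move=> x; apply/eqP/(xchooseP (ex x)).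
exists f'; first by exists f => // g; apply: f_inj; rewrite f'K.
move=> x y; rewrite -{1}[x]f'K -{1}[y]f'K -(f_adj (f' x)^-1%g) mulVg.
apply/idP/exists_inP => [Sxy|[s Ss /eqP->]]; last first.
  by move: Ss; rewrite mulKg inE.
by exists ((f' x)^-1 * f' y)%g; rewrite ?mulKVg ?inE.
Qed.

Section Cayley.
Variable n : nat.
Notation gT := (wreath * 'I_n.+1)%type.
Implicit Types g h k : gT.

Lemma arc_of_proof g :
  adj (g.1.1 : F8, flip g.1.1 g.1.2, g.2).1.1
      (g.1.1 : F8, flip g.1.1 g.1.2, g.2).1.2.
Proof. by apply/cube_adjP; exists g.1.2. Qed.

(** The image under [g] of the base arc, which leaves the origin in direction 0
    with index 0: the translation part of [g] becomes the tail and the rotation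
    part the direction. *)
Definition arc_of g : K n.+1 F8 :=
  Sub (g.1.1 : F8, flip g.1.1 g.1.2, g.2) (arc_of_proof g).

Lemma arc_of_inj : injective arc_of.
Proof.
move=> [[t i] k] [[t' i'] k'] e.
have et : t = t' := congr1 (@atail F8 n.+1) e.
have ek : k = k' := congr1 (@aidx F8 n.+1) e.
have := congr1 (@ahead F8 n.+1) e; rewrite /ahead /= et ek => /flip_inj ei.
by congr (_, _, _).
Qed.

Lemma arc_of_surj a : exists g, arc_of g = a.
Proof.
have /cube_adjP[i ea] := adj_arc a.
by exists ((atail a, i), aidx a); apply: marc_inj; rewrite // ea.
Qed.

(** The translation by the first unit vector, which exchanges the two ends of
    the base arc. *)
Definition reversal : gT := (([tuple i == 0%R | i < 3], 0%R), 1%g).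

(** Being a right multiplication, reversal commutes with left translations;
    this is why the group action preserves links. *)
Lemma rev_arc_of g : rev_arc (arc_of g) = arc_of (g * reversal)%g.
Proof.
have tail_e : (g * reversal)%g.1.1 = flip g.1.1 g.1.2.
  by apply: eq_from_tnth => j; rewrite !tnth_mktuple GRing.subr_eq0.
have dir_e : (g * reversal)%g.1.2 = g.1.2 by apply: GRing.addr0.
apply: marc_inj.
- exact: esym tail_e.
- by rewrite head_rev_arc [RHS](congr2 flip tail_e dir_e) flipK.
- by rewrite /aidx /= mulg1.
Qed.

Lemma tail_arc_ofM g h k :
  (atail (arc_of (g * h)%g) == atail (arc_of (g * k)%g))
    = (atail (arc_of h) == atail (arc_of k)).
Proof.
rewrite /atail /=; apply/eqP/eqP => [e|-> //].
apply: eq_from_tnth => i.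
have := congr1 (fun t => tnth t (i + g.1.2)%R) e.
by rewrite !tnth_mktuple /= GRing.addrK => /addbI.
Qed.

Lemma is_cayley_KF8 : is_cayley (K n.+1 F8).
Proof.
apply: (is_cayley_regular_param arc_of_inj arc_of_surj) => g h k.
rewrite !K_adjE tail_arc_ofM !rev_arc_of !(inj_eq arc_of_inj) -mulgA.
by rewrite !(inj_eq (mulgI g)).
Qed.

End Cayley.

Theorem theorem11 (m : nat) (m_gt0 : 0 < m) (m_mod4 : m = 2 %[mod 4]) :
  [/\ connected (K m F8),
      is_cayley (K m F8) &
      ~ exists D, @hamilton_decomposition (K m F8) (3 * m) D].
Proof.
split; last by case=> D; apply: K_F8_no_decomposition.
- exact: connected_K F8_regular isT m_gt0 connected_F8.
- by case: m m_gt0 {m_mod4} => // n _; apply: is_cayley_KF8.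
Qed.
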